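(* Let $\mathcal{C}=\{0,1\}^{\omega}$ be Cantor space and let $\gamma$ be the fair coin flip measure on $\mathcal{C}$. For every Borel probability measure $\tilde\gamma$ on $\mathcal{C}$ there exists a continuous partial realizer of $\tilde\gamma$ over $(\mathcal{C},\gamma)$, that is, a continuous partial mapping $F:\subseteq\mathcal{C}\to\mathcal{C}$ such that for every Borel set $V\subseteq\mathcal{C}$ the measure $\gamma\big(F^{-1}[V]\big)$ is defined and equal to $\tilde\gamma(V)$. Moreover, this realizer $F$ is defined on all of $\mathcal{C}$ with the exception of at most countably many points.
   Context: $\mathcal{C}=\{0,1\}^{\omega}$ carries the product topology and its Borel $\sigma$-algebra. For a finite word $\vec w\in\{0,1\}^n$ let $|\vec w|=n$ be its length, and let $\vec w\circ\mathcal{C}=\vec w\,\mathcal{C}$ denote the set of all infinite binary sequences having $\vec w$ as a prefix. The canonical (fair coin flip) measure $\gamma$ is the Borel probability measure on $\mathcal{C}$ with $\gamma(\vec w\circ\mathcal{C})=2^{-|\vec w|}$ for every finite word $\vec w$. The notation $F:\subseteq X\to Y$ means that $F$ is a partial mapping with domain $\mathrm{dom}(F)\subseteq X$; it is continuous if it is continuous on $\mathrm{dom}(F)$ with the subspace topology. For measure spaces $(X,\mathcal{A},\mu)$ and $(Y,\mathcal{B},\nu)$, a measurable partial mapping $F:\subseteq X\to Y$ realizes $\nu$ on (or: over) $\mu$ if $\mu(F^{-1}[V])$ is defined and equal to $\nu(V)$ for every $V\in\mathcal{B}$. *)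

(* Defs.v *)
From mathcomp Require Import all_boot all_order all_algebra.
From mathcomp Require Import all_classical all_reals all_analysis.
Set Implicit Arguments.
Unset Strict Implicit.
Unset Printing Implicit Defensive.
Import Order.TTheory GRing.Theory Num.Theory.
Import numFieldNormedType.Exports.

Local Open Scope classical_set_scope.
Local Open Scope ring_scope.

(* [g_sigma_algebraType] is an alias of its carrier, so [borel_cantor] and
   [cantor_space] are convertible: the former carries the Borel sigma-algebra,
   the latter the product topology. *)
Definition borel_cantor := g_sigma_algebraType (@open cantor_space).

Definition cylinder (w : seq bool) : set cantor_space :=
  [set x | mkseq x (size w) = w].

(* By the pi-lambda theorem at most one probability measure satisfies this. *)
Definition fair_coin_flip (R : realType) (gamma : probability borel_cantor R) :=
  forall w : seq bool, gamma (cylinder w) = (2^-1 ^+ size w)%:E.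

(* A partial mapping F :<= X -> Y is encoded as a total function [F] together
   with its domain [D], the values of [F] outside [D] being irrelevant; the
   preimage of V under the partial mapping is then [D `&` F @^-1` V]. *)
Definition realizes d1 d2 (X : measurableType d1) (Y : measurableType d2)
    (R : realType) (mu : {measure set X -> \bar R})
    (nu : {measure set Y -> \bar R}) (D : set X) (F : X -> Y) :=
  forall V : set Y, measurable V ->
    measurable (D `&` F @^-1` V) /\ mu (D `&` F @^-1` V) = nu V.

(* Main.v *)
(* Lay out the cylinders of each length n, in lexicographic order, as adjacent
   intervals of [0, 1] whose lengths are their masses, once for gamma and once
   for gamma'. A point x determines nested gamma-intervals (dyadic, of length
   2^-n), and F x is the sequence whose gamma'-intervals contain them. The bit
   of F x after a prefix w is 1 iff the gamma-interval of some prefix of x lies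
   to the right of the point c separating the gamma'-intervals of w0 and w1;
   the answer is already forced by a finite prefix of x unless every
   gamma-interval of x contains c in its interior. At most one x does so for
   each c, and there are only countably many words w, hence F is continuous off
   a countable set. That set is gamma-null, and F carries gamma to gamma'
   because gamma (x >= c) = 1 - c. *)
Require Import Defs.
From mathcomp Require Import all_boot all_order all_algebra.
From mathcomp Require Import all_classical all_reals all_analysis.
From mathcomp Require Import lra.
Import Order.TTheory GRing.Theory Num.Theory.
Import numFieldNormedType.Exports.

Set Implicit Arguments.
Unset Strict Implicit.
Unset Printing Implicit Defensive.

Local Open Scope classical_set_scope.
Local Open Scope ring_scope.

(** * Prefixes and cylinders as a base of the product topology *)

Lemma mkseq_eq_le (T : Type) (x y : nat -> T) (m n : nat) :
  (m <= n)%N -> mkseq x n = mkseq y n -> mkseq x m = mkseq y m.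
Proof.
move=> mn xy; have take_mkseq (z : nat -> T) : mkseq z m = take m (mkseq z n).
  by rewrite /mkseq -map_take take_iota (minn_idPl mn).
by rewrite !take_mkseq xy.
Qed.

Lemma cylinder_mkseq (x : cantor_space) (n : nat) : cylinder (mkseq x n) x.
Proof. by rewrite /cylinder /= size_mkseq. Qed.

Lemma cylinder_mkseqE (x y : cantor_space) (n : nat) :
  cylinder (mkseq x n) y = (mkseq y n = mkseq x n).
Proof. by rewrite /cylinder /= size_mkseq. Qed.

Lemma cylinderE (w : seq bool) (x : cantor_space) :
  cylinder w x -> cylinder w = cylinder (mkseq x (size w)).
Proof. by rewrite /cylinder /= => ->. Qed.

Lemma cylinder_nil : cylinder [::] = setT.
Proof. by apply/seteqP; split. Qed.

Lemma cylinder_rcons (w : seq bool) (b : bool) (x : cantor_space) :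
  cylinder (rcons w b) x <-> cylinder w x /\ x (size w) = b.
Proof.
rewrite /cylinder /= size_rcons mkseqS; split; last by move=> [-> ->].
by move/rcons_inj => [-> ->].
Qed.

Lemma setI_cylinder (v w : seq bool) (x : cantor_space) :
  cylinder v x -> cylinder w x ->
  cylinder v `&` cylinder w = cylinder (mkseq x (maxn (size v) (size w))).
Proof.
move=> /cylinderE -> /cylinderE ->; apply/seteqP; split => y /=;
  rewrite !cylinder_mkseqE.
  by case: (leqP (size v) (size w)) => _ [].
by move=> yx; split; apply: mkseq_eq_le yx; rewrite (leq_maxl, leq_maxr).
Qed.

Lemma nbhs_cylinder (x : cantor_space) (n : nat) :
  nbhs x (cylinder (mkseq x n)).
Proof.
elim: n => [|n IHn]; first by rewrite cylinder_nil; exact: filterT.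
have nx : nbhs x [set y : cantor_space | y n = x n].
  apply: (@proj_continuous nat (fun _ => bool) n x [set x n]).
  exact: discrete_set1.
apply: filterS2 IHn nx => y; rewrite !cylinder_mkseqE /= => yx ynx.
by rewrite !mkseqS yx ynx.
Qed.

Lemma nbhs_cantorP (x : cantor_space) (U : set cantor_space) :
  nbhs x U <-> exists n, cylinder (mkseq x n) `<=` U.
Proof.
split; last by move=> [n /filterS]; apply; exact: nbhs_cylinder.
pose G : set_system cantor_space :=
  filter_from [set: nat] (fun n => cylinder (mkseq x n)).
have fG : Filter G.
  apply: filter_from_filter; first by exists 0%N.
  move=> i j _ _; exists (maxn i j) => // y.
  rewrite cylinder_mkseqE => yx; split; rewrite cylinder_mkseqE;
    by apply: mkseq_eq_le yx; rewrite (leq_maxl, leq_maxr).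
suff /(_ U) Gx : G --> x by move=> /Gx[n _ ?]; exists n.
(* The product topology is the supremum of the topologies pulled back along the coordinates, so each
   coordinate is checked separately; coordinate [i] is fixed by a prefix of length [i.+1]. *)
apply/cvg_sup => i.
move=> V [_ [[W oW <-]]] /= Wx /filterS; apply.
exists i.+1 => // y; rewrite cylinder_mkseqE !mkseqS => /rcons_inj[_ yx] /=.
by rewrite yx.
Qed.

Lemma open_cylinder (w : seq bool) : open (cylinder w).
Proof.
rewrite openE => x wx; apply/nbhs_cantorP; exists (size w).
by rewrite -(cylinderE wx).
Qed.

Lemma measurable_cylinder (w : seq bool) :
  measurable (cylinder w : set borel_cantor).
Proof. by apply: sub_sigma_algebra; exact: open_cylinder. Qed.
#[local] Hint Resolve measurable_cylinder : core.

(** * Cylinders as a pi-system generating the Borel sigma-algebra *)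

(** The empty set is included because cylinders of incomparable words are disjoint. *)
Definition cylinders : set (set cantor_space) :=
  [set A | A = set0 \/ exists w, A = cylinder w].

Lemma setI_closed_cylinders : setI_closed cylinders.
Proof.
move=> A B [->|[v ->]]; first by left; rewrite set0I.
move=> [->|[w ->]]; first by left; rewrite setI0.
have [->|/set0P[x [vx wx]]] := eqVneq (cylinder v `&` cylinder w) set0.
  by left.
by right; rewrite (setI_cylinder vx wx); eexists.
Qed.

(** There are only countably many words, so an open set is a countable union of the cylinders it
    contains. *)
Lemma borel_cantorE :
  measurable = <<s cylinders >> :> set (set borel_cantor).
Proof.
apply/seteqP; split.
  apply: smallest_sub; first exact: smallest_sigma_algebra.
  move=> U; rewrite openE => oU.
  pose F w := if `[< cylinder w `<=` U >] then cylinder w else set0.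
  have -> : U = \bigcup_w F w.
    apply/seteqP; split => [x /oU /nbhs_cantorP[n nU]|x [w _]].
      exists (mkseq x n) => //; rewrite /F asboolT //.
      exact: cylinder_mkseq.
    by rewrite /F; case: asboolP => // wU /wU.
  apply: (@countable_bigcupT_measurable _ (g_sigma_algebraType cylinders)).
    exact: countableP.
  move=> w; apply: sub_sigma_algebra; rewrite /F.
  by case: ifP => _; [right; exists w|left].
apply: smallest_sub; first exact: smallest_sigma_algebra.
by move=> A [->|[w ->]]; [exact: measurable0|exact: measurable_cylinder].
Qed.

Lemma cylinder_rconsU (w : seq bool) :
  cylinder w = cylinder (rcons w false) `|` cylinder (rcons w true).
Proof.
apply/seteqP; split => [x wx|x].
  by case E: (x (size w)); [right|left]; apply/cylinder_rcons.
by case=> /cylinder_rcons[].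
Qed.

Lemma cylinder_rconsI (w : seq bool) :
  cylinder (rcons w false) `&` cylinder (rcons w true) = set0.
Proof.
apply/seteqP; split=> // x [] /cylinder_rcons[_ xw] /cylinder_rcons[_].
by rewrite xw.
Qed.

(** * Interval layout of a probability measure *)

Definition weight (R : realType) (mu : probability borel_cantor R)
    (w : seq bool) : R := fine (mu (cylinder w)).

(* The mass of the words of length [size w] lexicographically below [w]. *)
Definition left_end (R : realType) (mu : probability borel_cantor R)
    (w : seq bool) : R :=
  \sum_(i < size w | nth false w i) weight mu (rcons (take i w) false).

Definition right_end (R : realType) (mu : probability borel_cantor R)
    (w : seq bool) : R := left_end mu w + weight mu w.

Lemma weightE (R : realType) (mu : probability borel_cantor R) (w : seq bool) :
  mu (cylinder w) = (weight mu w)%:E.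
Proof. by rewrite /weight fineK // fin_num_measure. Qed.

Lemma weight_ge0 (R : realType) (mu : probability borel_cantor R)
    (w : seq bool) : 0 <= weight mu w.
Proof. by rewrite fine_ge0. Qed.

Lemma weight_nil (R : realType) (mu : probability borel_cantor R) :
  weight mu [::] = 1.
Proof. by apply: EFin_inj; rewrite -weightE cylinder_nil probability_setT. Qed.

Lemma weight_rcons (R : realType) (mu : probability borel_cantor R)
    (w : seq bool) :
  weight mu w = weight mu (rcons w false) + weight mu (rcons w true).
Proof.
apply: EFin_inj; rewrite EFinD -!weightE cylinder_rconsU measureU //.
exact: cylinder_rconsI.
Qed.

Lemma left_end_nil (R : realType) (mu : probability borel_cantor R) :
  left_end mu [::] = 0.
Proof. by rewrite /left_end big_ord0. Qed.

Lemma left_end_rcons (R : realType) (mu : probability borel_cantor R)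
    (w : seq bool) (b : bool) :
  left_end mu (rcons w b) =
  left_end mu w + (if b then weight mu (rcons w false) else 0).
Proof.
rewrite /left_end big_mkcond size_rcons big_ord_recr /= [in RHS]big_mkcond /=.
rewrite nth_rcons ltnn eqxx -cats1 take_size_cat //; congr (_ + _).
apply: eq_bigr => i _; rewrite nth_cat ltn_ord.
by rewrite takel_cat // ltnW.
Qed.

Lemma right_end_nil (R : realType) (mu : probability borel_cantor R) :
  right_end mu [::] = 1.
Proof. by rewrite /right_end left_end_nil weight_nil add0r. Qed.

(** The intervals of the two children tile that of [w], meeting at the cut
    [left_end mu (rcons w true)]. *)
Lemma right_end_rcons (R : realType) (mu : probability borel_cantor R)
    (w : seq bool) (b : bool) :
  right_end mu (rcons w b) =
  if b then right_end mu w else left_end mu (rcons w true).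
Proof.
rewrite /right_end !left_end_rcons (weight_rcons mu w).
by case: b; rewrite ?addr0 ?addrA.
Qed.

Lemma left_le_right (R : realType) (mu : probability borel_cantor R)
    (w : seq bool) : left_end mu w <= right_end mu w.
Proof. by rewrite lerDl weight_ge0. Qed.

Lemma left_end_mono (R : realType) (mu : probability borel_cantor R)
    (x : nat -> bool) :
  {homo (fun n => left_end mu (mkseq x n)) : m n / (m <= n)%N >-> m <= n}.
Proof.
apply: homo_leq => // [|n]; first by move=> ? ? ?; exact: le_trans.
by rewrite mkseqS left_end_rcons lerDl; case: ifP => // _; rewrite weight_ge0.
Qed.

Lemma right_end_mono (R : realType) (mu : probability borel_cantor R)
    (x : nat -> bool) :
  {homo (fun n => right_end mu (mkseq x n)) : m n / (m <= n)%N >-> n <= m}.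
Proof.
apply: homo_leq => // [|n]; first by move=> b a c ab bc; exact: le_trans ab.
rewrite mkseqS right_end_rcons; case: ifP => // _.
rewrite left_end_rcons /right_end lerD2l (weight_rcons _ (mkseq _ _)) lerDl.
exact: weight_ge0.
Qed.

(** * Half-lines in Cantor space and their fair measure *)

(* For fair [g]: [c <= x] for the real number with binary digits [x], except
   that a dyadic [c > 0] is not recognized from its expansion ending in ones. *)
Definition above (R : realType) (g : probability borel_cantor R) (c : R) :
  set cantor_space := [set x | exists n, c <= left_end g (mkseq x n)].

Lemma open_above (R : realType) (g : probability borel_cantor R) (c : R) :
  open (above g c).
Proof.
rewrite openE => x [n cx]; apply/nbhs_cantorP; exists n => y.
by rewrite cylinder_mkseqE => yx; exists n; rewrite yx.
Qed.

Lemma measurable_above (R : realType) (g : probability borel_cantor R) (c : R) :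
  measurable (above g c : set borel_cantor).
Proof. by apply: sub_sigma_algebra; exact: open_above. Qed.
#[local] Hint Resolve measurable_above : core.

Lemma sub_above (R : realType) (g : probability borel_cantor R) (c d : R) :
  c <= d -> above g d `<=` above g c.
Proof. by move=> cd x [n dx]; exists n; exact: le_trans dx. Qed.

Lemma weight_fair (R : realType) (g : probability borel_cantor R)
    (w : seq bool) : fair_coin_flip g -> weight g w = 2^-1 ^+ size w.
Proof. by move=> fg; rewrite /weight fg. Qed.

(** Intervals along a path are nested, and the one at depth [maxn m n] has positive length by
    fairness. *)
Lemma left_lt_right (R : realType) (g : probability borel_cantor R)
    (x : nat -> bool) (m n : nat) : fair_coin_flip g ->
  left_end g (mkseq x m) < right_end g (mkseq x n).
Proof.
move=> fg; apply: le_lt_trans (left_end_mono g x (leq_maxl m n)) _.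
apply: lt_le_trans (right_end_mono g x (leq_maxr m n)).
by rewrite ltrDl weight_fair // exprn_gt0 // invr_gt0.
Qed.

(* The words leaving the path [y] within its first [n] steps on the side
   opposite to a turn [b]: lexicographically below [y] if [b = true], above
   otherwise. *)
Definition side (b : bool) (y : nat -> bool) (n : nat) : set cantor_space :=
  [set x | exists i,
     [/\ (i < n)%N, y i = b & cylinder (rcons (mkseq y i) (~~ b)) x]].

Lemma sideS (b : bool) (y : nat -> bool) (n : nat) :
  side b y n.+1 = side b y n `|`
    (if y n == b then cylinder (rcons (mkseq y n) (~~ b)) else set0).
Proof.
apply/seteqP; split=> x.
  move=> [i []]; rewrite ltnS leq_eqVlt => /predU1P[->|ilt] yb xi.
    by right; rewrite yb eqxx.
  by left; exists i.
case=> [[i [ilt yb xi]]|]; first by exists i; split=> //; exact: ltnW.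
by case: eqP => // yb xn; exists n.
Qed.

Lemma side_cylinder (b : bool) (y : nat -> bool) (n : nat) :
  side b y n `&` cylinder (mkseq y n) = set0.
Proof.
apply/seteqP; split=> // x [[i [ilt yb /cylinder_rcons[_]]]].
rewrite size_mkseq => xi; rewrite cylinder_mkseqE => /(mkseq_eq_le ilt).
by rewrite !mkseqS => /rcons_inj[_]; rewrite xi yb; case: b {yb xi}.
Qed.

Lemma measurable_side (b : bool) (y : nat -> bool) (n : nat) :
  measurable (side b y n : set borel_cantor).
Proof.
elim: n => [|n IHn]; last by rewrite sideS; apply: measurableU => //; case: ifP.
by rewrite (_ : side _ _ _ = set0) //; apply/seteqP; split=> // x [i []].
Qed.

(** Each turn [b] of [y] adds one sibling cylinder, disjoint from the earlier ones, whose mass is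
    exactly the distance by which the corresponding endpoint moves. *)
Lemma measure_side (R : realType) (mu : probability borel_cantor R)
    (b : bool) (y : nat -> bool) (n : nat) :
  mu (side b y n) =
  (if b then left_end mu (mkseq y n) else 1 - right_end mu (mkseq y n))%:E.
Proof.
elim: n => [|n IHn].
  rewrite (_ : side _ _ _ = set0); last by apply/seteqP; split=> // x [i []].
  by rewrite measure0 left_end_nil right_end_nil subrr if_same.
have dis : side b y n `&`
    (if y n == b then cylinder (rcons (mkseq y n) (~~ b)) else set0) = set0.
  case: ifP => _; last exact: setI0.
  apply/seteqP; split=> // x [sx] /cylinder_rcons[cx _].
  by rewrite -(side_cylinder b y n).
rewrite sideS measureU //; first last.
- by case: ifP.
- exact: measurable_side.
rewrite [X in (X + _)%E]IHn mkseqS left_end_rcons right_end_rcons.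
rewrite left_end_rcons.
rewrite /right_end (weight_rcons mu (mkseq y n)).
case: b {IHn dis}; case: (y n);
  rewrite ?measure0 ?adde0 ?addr0 //= weightE -EFinD //.
by congr EFin; rewrite !opprD !addrA subrK.
Qed.

(** A bit may depend on all earlier bits, so the sequence is built through its finite prefixes. *)
Fixpoint walk (d : seq bool -> bool) (n : nat) : seq bool :=
  if n is m.+1 then rcons (walk d m) (d (walk d m)) else [::].

Definition branch (d : seq bool -> bool) : cantor_space :=
  fun n => d (walk d n).

Lemma mkseq_branch (d : seq bool -> bool) (n : nat) :
  mkseq (branch d) n = walk d n.
Proof. by elim: n => //= n IHn; rewrite mkseqS IHn. Qed.

Lemma branchE (d : seq bool -> bool) (n : nat) :
  branch d n = d (mkseq (branch d) n).
Proof. by rewrite mkseq_branch. Qed.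

Lemma expansion (R : realType) (mu : probability borel_cantor R) (c : R) :
  0 <= c <= 1 -> exists y : nat -> bool, forall n,
    left_end mu (mkseq y n) <= c <= right_end mu (mkseq y n).
Proof.
(* Greedy digits: turn right exactly when the cut between the two children is at most [c]. *)
move=> c01; exists (branch (fun w => left_end mu (rcons w true) <= c)) => n.
elim: n => [|n]; first by rewrite left_end_nil right_end_nil.
rewrite mkseqS branchE; set w := mkseq _ _; move=> /andP[lw rw].
have [le_c|lt_c] := leP (left_end mu (rcons w true)) c; rewrite right_end_rcons.
  by rewrite le_c.
by rewrite left_end_rcons addr0 lw ltW.
Qed.

(** Along an expansion [y] of [c], the words leaving [y] to the right lie in [above g c] and those
    leaving it to the left lie outside. This confines the measure to an interval of length
    [2^-1 ^+ n] that also contains [1 - c]. *)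
Lemma measure_above (R : realType) (g : probability borel_cantor R) (c : R) :
  fair_coin_flip g -> 0 <= c <= 1 -> g (above g c) = (1 - c)%:E.
Proof.
move=> fg /(expansion g)[y cy].
have sub_true n : side true y n `<=` ~` above g c.
  move=> x [i [_ yi]]; rewrite /cylinder /= size_rcons size_mkseq => xi [m cx].
  (* After leaving [y] to the left, the right end for [x] is the left end for [y], hence at most
     [c], and no left end along [x] can reach it. *)
  have := left_lt_right x m i.+1 fg.
  rewrite xi right_end_rcons /= ltNge; apply/negP; rewrite negbK.
  apply: le_trans cx.
  by have /andP[+ _] := cy i.+1; rewrite mkseqS yi.
have sub_false n : side false y n `<=` above g c.
  move=> x [i [_ yi]]; rewrite /cylinder /= size_rcons size_mkseq => xi.
  exists i.+1; rewrite xi; have /andP[_] := cy i.+1.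
  by rewrite mkseqS yi right_end_rcons.
have gfin : g (above g c) \is a fin_num by exact: fin_num_measure.
rewrite -(fineK gfin); congr EFin.
set a := fine _.
have aE : g (above g c) = a%:E by rewrite fineK.
apply/eqP; rewrite -subr_eq0 -normr_le0; apply/ler_addgt0Pl => e e0.
rewrite addr0.
have [n ne] : exists n, 2^-1 ^+ n < e.
  by have [n _ /(_ n (leqnn n))] := near_infty_natSinv_expn_lt (PosNum e0);
    exists n; rewrite exprVn -div1r.
apply: le_trans (ltW ne).
have lo : left_end g (mkseq y n) <= 1 - a.
  rewrite -lee_fin EFinB -aE -probability_setC //.
  rewrite -(measure_side g true) le_measure ?inE //.
  - exact: measurable_side.
  - exact: measurableC.
have hi : 1 - right_end g (mkseq y n) <= a.
  rewrite -lee_fin -aE -(measure_side g false) le_measure ?inE //.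
  exact: measurable_side.
have /andP[] := cy n.
rewrite ler_norml; move: lo hi.
rewrite /right_end (weight_fair _ fg) size_mkseq.
lra.
Qed.

(** * The transport map and its image measure *)

(** The map is total, so its image measure can be computed on the whole space before any point is
    removed from the domain. *)
Definition transport (R : realType) (g mu : probability borel_cantor R)
    (x : cantor_space) : cantor_space :=
  branch (fun w => `[< above g (left_end mu (rcons w true)) x >]).

Lemma transportE (R : realType) (g mu : probability borel_cantor R)
    (x : cantor_space) (n : nat) :
  transport g mu x n =
  `[< above g (left_end mu (rcons (mkseq (transport g mu x) n) true)) x >].
Proof. exact: branchE. Qed.

Lemma left_ge0_right_le1 (R : realType) (mu : probability borel_cantor R)
    (w : seq bool) :
  0 <= left_end mu w /\ right_end mu w <= 1.
Proof.
split; first by rewrite sumr_ge0 // => i _; rewrite weight_ge0.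
elim/last_ind: w => [|w b IHw]; first by rewrite right_end_nil.
rewrite right_end_rcons; case: b => //.
apply: le_trans IHw; rewrite -(right_end_rcons mu w true).
exact: left_le_right.
Qed.

(** Appending a bit to [w] intersects the preimage with [above] of the cut or with its complement;
    as [above] decreases in its threshold, only two thresholds survive. *)
Lemma preimage_transport (R : realType) (g mu : probability borel_cantor R)
    (w : seq bool) : fair_coin_flip g ->
  transport g mu @^-1` cylinder w =
  above g (left_end mu w) `\` above g (right_end mu w).
Proof.
move=> fg; elim/last_ind: w => [|w b IHw].
  rewrite left_end_nil right_end_nil cylinder_nil preimage_setT.
  apply/seteqP; split=> // x _; split.
    by exists 0%N; rewrite left_end_nil.
  (* [above g 1] is empty: every left end is strictly below [right_end g [::]], which is 1. *)
  move=> [n]; apply/negP; rewrite -ltNge -(right_end_nil g).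
  exact: (left_lt_right x n 0).
have lr : left_end mu (rcons w true) <= right_end mu w.
  by rewrite -(right_end_rcons mu w true) left_le_right.
have ll : left_end mu w <= left_end mu (rcons w true).
  by rewrite left_end_rcons lerDl weight_ge0.
have -> : transport g mu @^-1` cylinder (rcons w b) =
    (transport g mu @^-1` cylinder w) `&`
    [set x | `[< above g (left_end mu (rcons w true)) x >] = b].
  apply/seteqP; split=> x.
    by move=> /cylinder_rcons[wx <-]; split=> //=; rewrite transportE wx.
  by move=> [wx /= <-]; apply/cylinder_rcons; split=> //; rewrite transportE wx.
rewrite IHw right_end_rcons; apply/seteqP; case: b; split=> x.
- by move=> [[? ?]] /asboolP.
- move=> [lx rx]; split; last exact/asboolP.
  by split=> //; exact: sub_above ll _ lx.
- by move=> [[lx rx]] /asboolPn nx; rewrite left_end_rcons addr0.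
- rewrite left_end_rcons addr0 => -[lx nx]; split; last exact/asboolPn.
  by split=> // rx; apply: nx; exact: sub_above lr _ rx.
Qed.

(** The two half-lines have measures [1 - left_end mu w] and [1 - right_end mu w], which differ by
    the length of the interval of [w]. *)
Lemma measure_preimage_transport (R : realType)
    (g mu : probability borel_cantor R) (w : seq bool) : fair_coin_flip g ->
  g (transport g mu @^-1` cylinder w) = mu (cylinder w).
Proof.
move=> fg; have [l0 r1] := left_ge0_right_le1 mu w.
have lr := left_le_right mu w.
rewrite preimage_transport // measureD //; last first.
  by rewrite ltey_eq fin_num_measure.
rewrite setIidr; last exact: sub_above.
rewrite [X in (X - _)%E]measure_above ?l0 ?(le_trans lr) //.
rewrite [X in (_ - X)%E]measure_above ?r1 ?(le_trans l0) // weightE.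
by rewrite -EFinB /right_end; congr EFin; lra.
Qed.

Lemma measurable_transport (R : realType) (g mu : probability borel_cantor R) :
  fair_coin_flip g ->
  measurable_fun setT (transport g mu : borel_cantor -> borel_cantor).
Proof.
move=> fg.
apply: (@measurability _ _ borel_cantor borel_cantor _ _ _ borel_cantorE).
move=> _ [_ [->|[w ->]] <-]; rewrite setTI.
  by rewrite preimage_set0.
by rewrite preimage_transport //; exact: measurableD.
Qed.

(** Pi-lambda uniqueness: the image measure and [mu] agree on the generating pi-system of
    cylinders. *)
Lemma transport_measure (R : realType) (g mu : probability borel_cantor R)
    (V : set borel_cantor) : fair_coin_flip g -> measurable V ->
  g (transport g mu @^-1` V) = mu V.
Proof.
move=> fg mV; have mF := measurable_transport mu fg.
pose F : borel_cantor -> borel_cantor := transport g mu.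
pose m1 : {measure set borel_cantor -> \bar R} := pushforward g F.
apply: (@measure_unique _ _ borel_cantor cylinders (fun=> setT) borel_cantorE
  setI_closed_cylinders _ _ (m1 mF) mu) => //.
- by move=> _; right; exists [::]; rewrite cylinder_nil.
- by rewrite bigcup_const //; exists 0%N.
- move=> A [->|[w ->]]; first by rewrite !measure0.
  exact: measure_preimage_transport.
- by move=> _; rewrite /m1 /= /pushforward preimage_setT probability_setT ltry.
Qed.

(** * The exceptional set: countable and null *)

Definition straddling (R : realType) (g : probability borel_cantor R) (c : R) :
  set cantor_space :=
  [set x | forall n, left_end g (mkseq x n) < c < right_end g (mkseq x n)].

(** Strict inequalities force every bit of a straddling point: it is 1 iff the cut of the current
    interval lies below [c]. *)
Lemma is_subset1_straddling (R : realType) (g : probability borel_cantor R)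
    (c : R) : is_subset1 (straddling g c).
Proof.
have step x n : straddling g c x ->
    x n = (left_end g (rcons (mkseq x n) true) < c).
  move=> /(_ n.+1); rewrite mkseqS right_end_rcons; case: (x n) => /andP[lt gt].
    by rewrite lt.
  by rewrite ltNge (ltW gt).
move=> x y sx sy; suff xy n : mkseq x n = mkseq y n.
  by apply/funext => n; rewrite (step x) // xy -step.
by elim: n => // n IHn; rewrite !mkseqS (step x) // (step y) // IHn.
Qed.

Lemma not_straddling (R : realType) (g : probability borel_cantor R) (c : R)
    (x : cantor_space) : ~ straddling g c x ->
  exists n, c <= left_end g (mkseq x n) \/ right_end g (mkseq x n) <= c.
Proof.
move=> /existsNP[n /negP]; rewrite negb_and -!leNgt => /orP nx.
by exists n.
Qed.

Lemma measurable_cantor_set1 (x : cantor_space) :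
  measurable ([set x] : set borel_cantor).
Proof.
have -> : [set x] = \bigcap_n cylinder (mkseq x n).
  apply/seteqP; split => [_ -> n _|y xy]; first exact: cylinder_mkseq.
  apply/funext => n; have /= := xy n.+1 I.
  by rewrite cylinder_mkseqE !mkseqS => /rcons_inj[].
by apply: (@bigcapT_measurable _ borel_cantor) => n.
Qed.

Lemma fair_set1 (R : realType) (g : probability borel_cantor R)
    (x : cantor_space) : fair_coin_flip g -> g [set x] = 0%E.
Proof.
move=> fg; apply/eqP; rewrite -measure_le0; apply/lee_addgt0Pr => e e0.
rewrite add0e.
have [n _ /(_ n (leqnn n)) ne] := near_infty_natSinv_expn_lt (PosNum e0).
apply: (@le_trans _ _ (g (cylinder (mkseq x n)))).
  apply: le_measure; rewrite ?inE //; first exact: measurable_cantor_set1.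
  by move=> _ ->; exact: cylinder_mkseq.
by rewrite fg size_mkseq lee_fin exprVn -div1r ltW.
Qed.

Definition exceptional (R : realType) (g mu : probability borel_cantor R) :
  set cantor_space :=
  \bigcup_w straddling g (left_end mu (rcons w true)).

Lemma straddling_eq01 (R : realType) (g : probability borel_cantor R) (c : R) :
  straddling g c = set0 \/ exists x, straddling g c = [set x].
Proof.
have [->|/set0P[x sx]] := eqVneq (straddling g c) set0; [by left|right].
exists x; apply/seteqP; split => [y sy|_ -> //].
exact: is_subset1_straddling sy sx.
Qed.

Lemma countable_exceptional (R : realType) (g mu : probability borel_cantor R) :
  countable (exceptional g mu).
Proof.
apply: bigcup_countable => [|w _]; first exact: countableP.
by case: (straddling_eq01 g (left_end mu (rcons w true))) => [->|[x ->]];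
  [exact: countable0|exact: countable1].
Qed.

Lemma measurable_exceptional (R : realType)
    (g mu : probability borel_cantor R) :
  measurable (exceptional g mu : set borel_cantor).
Proof.
apply: (@countable_measurable _ borel_cantor).
  exact: measurable_cantor_set1.
exact: countable_exceptional.
Qed.

Lemma measure_exceptional (R : realType) (g mu : probability borel_cantor R) :
  fair_coin_flip g -> g (exceptional g mu) = 0%E.
Proof.
move=> fg; apply/negligibleP; first exact: measurable_exceptional.
(* The union over words is reindexed by natural numbers; those coding no word contribute the empty
   set. *)
pose F n := if unpickle n is Some w
  then straddling g (left_end mu (rcons w true)) else set0.
have : exceptional g mu `<=` \bigcup_n F n.
  by move=> x [w _ sx]; exists (pickle w) => //; rewrite /F pickleK.
move=> /(@negligibleS _ borel_cantor R g); apply.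
apply: negligible_bigcup => n; rewrite /F.
case: unpickle => [w|]; last exact: negligible_set0.
case: (straddling_eq01 g (left_end mu (rcons w true))) => [->|[x ->]].
  exact: negligible_set0.
apply/negligibleP; first exact: measurable_cantor_set1.
exact: fair_set1.
Qed.

(** * Continuity off the exceptional set *)

(** Off the exceptional set each comparison with a cut is settled by a finite prefix of [x], so
    every further bit of the image only shrinks the neighbourhood. *)
Lemma transport_locally_constant (R : realType)
    (g mu : probability borel_cantor R) (x : cantor_space) (n : nat) :
  fair_coin_flip g -> ~ exceptional g mu x ->
  nbhs x (transport g mu @^-1` cylinder (mkseq (transport g mu x) n)).
Proof.
move=> fg Ex; elim: n => [|n IHn].
  by rewrite cylinder_nil preimage_setT; exact: filterT.
set w := mkseq _ n in IHn *; pose c := left_end mu (rcons w true).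
have [k xk] : exists k,
    c <= left_end g (mkseq x k) \/ right_end g (mkseq x k) <= c.
  by apply: not_straddling => sx; apply: Ex; exists w.
have near_c : nbhs x [set y | `[< above g c y >] = `[< above g c x >]].
  apply/nbhs_cantorP; exists k => y /=; rewrite cylinder_mkseqE => yx.
  apply/asbool_equiv_eq; case: xk => xk.
    by split=> _; exists k; rewrite ?yx.
  (* If the interval at depth [k] ends at or before [c], no point sharing this prefix is above [c],
     since its left ends stay strictly below that right end. *)
  split=> -[m /(le_trans xk)]; last by rewrite leNgt left_lt_right.
  by rewrite -yx leNgt left_lt_right.
apply: filterS2 IHn near_c => y wy yx.
rewrite mkseqS /=; apply/cylinder_rcons; split=> //.
rewrite size_mkseq [LHS]transportE [RHS]transportE.
by move: wy; rewrite /= cylinder_mkseqE => ->.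
Qed.

Lemma continuous_transport (R : realType) (g mu : probability borel_cantor R) :
  fair_coin_flip g -> {within ~` exceptional g mu, continuous (transport g mu)}.
Proof.
move=> fg; apply: continuous_in_subspaceT => x; rewrite inE => Ex.
move=> U /nbhs_cantorP[n nU].
by apply: filterS (transport_locally_constant n fg Ex) => y /nU.
Qed.

Theorem theorem4 (R : realType)
    (gamma : probability borel_cantor R) (hgamma : fair_coin_flip gamma)
    (gamma' : probability borel_cantor R) :
  exists (D : set cantor_space) (F : cantor_space -> cantor_space),
    [/\ {within D, continuous F},
        realizes gamma gamma' D F
      & countable (~` D)].
Proof.
pose E := exceptional gamma gamma'; pose F := transport gamma gamma'.
exists (~` E), F; split; first exact: continuous_transport.
  move=> V mV.
  have mE : measurable (E : set borel_cantor) by exact: measurable_exceptional.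
  have mFV : measurable (F @^-1` V : set borel_cantor).
    by rewrite -[X in measurable X]setTI; exact: measurable_transport.
  rewrite setIC -setDE; split; first exact: measurableD.
  transitivity (gamma (F @^-1` V)); last exact: transport_measure.
  (* Split the full preimage along [E]; the part inside [E] is null. *)
  rewrite [RHS](measureDI gamma mFV mE).
  rewrite [X in (_ = _ + X)%E](_ : _ = 0%E) ?adde0 //.
  apply: (@subset_measure0 _ _ _ gamma _ E) => //; first exact: measurableI.
  exact: measure_exceptional.
by rewrite setCK; exact: countable_exceptional.
Qed.
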